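(* Consider the finite volume scheme for the collisionless five-moment system $\partial_t\mathbf M+\partial_x\mathbf F(\mathbf M)=0$ on a uniform grid of size $\Delta x>0$ with time step $\Delta t_n>0$, $$\overline{\mathbf M}^{n+1}_i=\overline{\mathbf M}^n_i-\frac{\Delta t_n}{\Delta x}\Big(\widehat{\mathbf F}(\mathbf M^{n,-}_{i+\frac12},\mathbf M^{n,+}_{i+\frac12})-\widehat{\mathbf F}(\mathbf M^{n,-}_{i-\frac12},\mathbf M^{n,+}_{i-\frac12})\Big),$$ where $\mathbf F$ is the flux of either the two-node Gaussian-EQMOM closure or the three-point HyQMOM closure, $\widehat{\mathbf F}$ is the corresponding HLL flux, and the interface values $\mathbf M^{n,\mp}_{i\pm\frac12}$ are obtained from the cell averages by linear reconstruction (all specified in the context). Assume that $\overline{\mathbf M}^n_i$ is strictly realizable (i.e. $\overline{\mathbf M}^n_i\in\Omega_2$) for all $i$. If the reconstructed values $\mathbf M^{n,\pm}_{i+\frac12}$ are strictly realizable (i.e. $\mathbf M^{n,\pm}_{i+\frac12}\in\Omega_2$) for all $i$, then, under the CFL condition $$\frac{\Delta t_n}{\Delta x}\max_i\big\{\delta^{n,+}_{i+\frac12}-\delta^{n,-}_{i+\frac12}\big\}\le\frac12,$$ the updated $\overline{\mathbf M}^{n+1}_i$ is, for all $i$, strictly realizable in the case of Gaussian-EQMOM and realizable in the case of HyQMOM.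
   Context: **Realizability.** A vector $\mathbf M=(M_0,\dots,M_4)^\top\in\mathbb R^5$ is realizable if there is a nonnegative distribution (finite nonnegative Borel measure, e.g. a sum of Dirac masses) $f$ on $\mathbb R$ with $M_k=\int_{\mathbb R} v^k\,df(v)$, $k=0,\dots,4$. It is strictly realizable if it lies in the interior $\Omega_2$ of the set of realizable vectors; equivalently, its Hankel matrix $\mathcal H_2(\mathbf M)=(M_{j+k})_{0\le j,k\le2}$ is positive definite. **Flux.** $\mathbf F(\mathbf M)=(M_1,M_2,M_3,M_4,\overline M_5)^\top$, where $\overline M_5$ is given by one of the following closures. (G) Two-node Gaussian-EQMOM: there are primitive variables $(\rho_1,v_1,\rho_2,v_2,\sigma)$ with $\rho_1,\rho_2,\sigma>0$ solving $M_0=\rho_1+\rho_2$, $M_1=\rho_1v_1+\rho_2v_2$, $M_2=\rho_1v_1^2+\rho_2v_2^2+\sigma^2M_0$, $M_3=\rho_1v_1^3+\rho_2v_2^3+3\sigma^2M_1$, $M_4=\rho_1v_1^4+\rho_2v_2^4+6\sigma^2M_2-3\sigma^4M_0$, and $\overline M_5=\rho_1v_1^5+\rho_2v_2^5+10\sigma^2M_3-15\sigma^4M_1$ (the fifth moment of the sum of the Gaussians with weights $\rho_i$, means $v_i$ and variance $\sigma^2$). Standing assumption: all strictly realizable vectors at which $\mathbf F$ is evaluated admit such primitive variables (this only excludes a measure-zero subset of $\Omega_2$). For a fixed constant $a>\sqrt3$ set $\delta^+(\mathbf M)=\max\{v_1+a\sigma,v_2+a\sigma,0\}$, $\delta^-(\mathbf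 M)=\min\{v_1-a\sigma,v_2-a\sigma,0\}$. (H) Three-point HyQMOM: the primitive variables $\rho_1,\rho_2,\rho_3>0$, $v_1,v_3$ solve $M_k=\sum_{i=1}^3\rho_iv_i^k$ for $k=0,\dots,4$ with $v_2=M_1/M_0$, and $\overline M_5=\sum_{i=1}^3\rho_iv_i^5$. Set $\delta^+(\mathbf M)=\max\{v_1,v_2,v_3,0\}$, $\delta^-(\mathbf M)=\min\{v_1,v_2,v_3,0\}$. **HLL flux.** $$\widehat{\mathbf F}(\mathbf M^-,\mathbf M^+)=\frac{\hat\delta^+\mathbf F(\mathbf M^-)-\hat\delta^-\mathbf F(\mathbf M^+)+\hat\delta^+\hat\delta^-(\mathbf M^+-\mathbf M^-)}{\hat\delta^+-\hat\delta^-},$$ with $\hat\delta^+=\max\{\delta^+(\mathbf M^+),\delta^+(\mathbf M^-)\}$ and $\hat\delta^-=\min\{\delta^-(\mathbf M^+),\delta^-(\mathbf M^-)\}$. The interface speeds $\delta^{n,\pm}_{i+\frac12}$ are the values of $\hat\delta^\pm$ at $(\mathbf M^{n,+}_{i+\frac12},\mathbf M^{n,-}_{i+\frac12})$. **Reconstruction.** $\mathbf M^{n,\mp}_{i\pm\frac12}=\overline{\mathbf M}^n_i\pm\frac{\Delta x}{2}(\widehat{\mathbf M}^n_x)_i$, where the slope $(\widehat{\mathbf M}^n_x)_i$ is computed componentwise by the van Albada limiter: with $p=(\overline{M}_{i+1}-\overline{M}_i)/\Delta x$, $m=(\overline{M}_i-\overline{M}_{i-1})/\Delta x$ for a given component,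 the slope is $\frac{(p^2+\varepsilon_R)m+(m^2+\varepsilon_L)p}{m^2+p^2+\varepsilon_L+\varepsilon_R}$ with $\varepsilon_L=\varepsilon_R=3\Delta x$. The index $i$ runs over all grid cells, and the maximum is over all cell interfaces. *)

(* Defs.v *)
From mathcomp Require Import all_boot all_order all_algebra.
From mathcomp Require Import all_classical all_reals all_analysis.
Import Order.TTheory GRing.Theory Num.Theory.
Import numFieldNormedType.Exports.

Set Implicit Arguments.
Unset Strict Implicit.
Unset Printing Implicit Defensive.

Local Open Scope classical_set_scope.
Local Open Scope ring_scope.

(* [mom M k] is M_k for [k < 5]; it is never used with larger [k]. *)
Definition mom (R : realType) (M : 'cV[R]_5) (k : nat) : R := M (inord k) 0.

Definition realizable (R : realType) (M : 'cV[R]_5) : Prop :=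
  exists f : {finite_measure set (measurableTypeR R) -> \bar R},
    forall k : nat, (k < 5)%N ->
      f.-integrable setT (fun v : measurableTypeR R => (v ^+ k)%:E) /\
      (mom M k)%:E = (\int[f]_(v in setT) (v ^+ k)%:E)%E.

Definition strictly_realizable (R : realType) (M : 'cV[R]_5) : Prop :=
  interior [set N : 'cV[R]_5 | realizable N] M.

(* A closure gives the fifth moment M5 and the speeds delta^+ and delta^-. *)
Record moment_closure (R : realType) := MomentClosure {
  fifth_moment : 'cV[R]_5 -> R;
  speed_max : 'cV[R]_5 -> R;
  speed_min : 'cV[R]_5 -> R
}.

(* Tuples of primitive variables are (rho1, v1, rho2, v2, sigma). *)
Definition geqmom_primitive (R : realType) (M : 'cV[R]_5)
    (p : R * R * R * R * R) : Prop :=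
  let: (rho1, v1, rho2, v2, sigma) := p in
  [/\ 0 < rho1, 0 < rho2 & 0 < sigma] /\
  [/\ mom M 0 = rho1 + rho2,
      mom M 1 = rho1 * v1 + rho2 * v2,
      mom M 2 = rho1 * v1 ^+ 2 + rho2 * v2 ^+ 2 + sigma ^+ 2 * mom M 0,
      mom M 3 = rho1 * v1 ^+ 3 + rho2 * v2 ^+ 3 + 3 * sigma ^+ 2 * mom M 1
    & mom M 4 = rho1 * v1 ^+ 4 + rho2 * v2 ^+ 4
                + 6 * sigma ^+ 2 * mom M 2 - 3 * sigma ^+ 4 * mom M 0].

Definition geqmom_admissible (R : realType) (M : 'cV[R]_5) : Prop :=
  exists p, geqmom_primitive M p.

(* Primitive variables are unique up to exchanging the two nodes, and up to the
   splitting of the weight when v1 = v2; the closure below does not depend on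
   the choice.  The default value is only taken at non-admissible vectors. *)
Definition geqmom_prim (R : realType) (M : 'cV[R]_5) : R * R * R * R * R :=
  xget (0, 0, 0, 0, 0) [set p | geqmom_primitive M p].

Definition geqmom (R : realType) (a : R) : moment_closure R := {|
  fifth_moment := fun M =>
    let: (rho1, v1, rho2, v2, sigma) := geqmom_prim M in
    rho1 * v1 ^+ 5 + rho2 * v2 ^+ 5
    + 10 * sigma ^+ 2 * mom M 3 - 15 * sigma ^+ 4 * mom M 1;
  speed_max := fun M =>
    let: (_, v1, _, v2, sigma) := geqmom_prim M in
    Num.max (Num.max (v1 + a * sigma) (v2 + a * sigma)) 0;
  speed_min := fun M =>
    let: (_, v1, _, v2, sigma) := geqmom_prim M in
    Num.min (Num.min (v1 - a * sigma) (v2 - a * sigma)) 0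
|}.

(* Tuples of primitive variables are (rho1, v1, rho2, v2, rho3, v3). *)
Definition hyqmom_primitive (R : realType) (M : 'cV[R]_5)
    (p : R * R * R * R * R * R) : Prop :=
  let: (rho1, v1, rho2, v2, rho3, v3) := p in
  [/\ 0 < rho1, 0 < rho2, 0 < rho3, v2 = mom M 1 / mom M 0
    & forall k : nat, (k < 5)%N ->
        mom M k = rho1 * v1 ^+ k + rho2 * v2 ^+ k + rho3 * v3 ^+ k].

(* Primitive variables exist at every strictly realizable vector and are unique
   up to exchanging the outer nodes v1 and v3. *)
Definition hyqmom_prim (R : realType) (M : 'cV[R]_5) : R * R * R * R * R * R :=
  xget (0, 0, 0, 0, 0, 0) [set p | hyqmom_primitive M p].

Definition hyqmom (R : realType) : moment_closure R := {|
  fifth_moment := fun M =>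
    let: (rho1, v1, rho2, v2, rho3, v3) := hyqmom_prim M in
    rho1 * v1 ^+ 5 + rho2 * v2 ^+ 5 + rho3 * v3 ^+ 5;
  speed_max := fun M =>
    let: (_, v1, _, v2, _, v3) := hyqmom_prim M in
    Num.max (Num.max (Num.max v1 v2) v3) 0;
  speed_min := fun M =>
    let: (_, v1, _, v2, _, v3) := hyqmom_prim M in
    Num.min (Num.min (Num.min v1 v2) v3) 0
|}.

Definition flux (R : realType) (C : moment_closure R) (M : 'cV[R]_5) : 'cV[R]_5 :=
  \col_(k < 5) (if (k < 4)%N then mom M k.+1 else fifth_moment C M).

Definition hll_speed_max (R : realType) (C : moment_closure R) (Mm Mp : 'cV[R]_5) : R :=
  Num.max (speed_max C Mp) (speed_max C Mm).

Definition hll_speed_min (R : realType) (C : moment_closure R) (Mm Mp : 'cV[R]_5) : R :=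
  Num.min (speed_min C Mp) (speed_min C Mm).

Definition hll_flux (R : realType) (C : moment_closure R) (Mm Mp : 'cV[R]_5) :
    'cV[R]_5 :=
  let dp := hll_speed_max C Mm Mp in
  let dm := hll_speed_min C Mm Mp in
  (dp - dm)^-1 *:
    (dp *: flux C Mm - dm *: flux C Mp + (dp * dm) *: (Mp - Mm)).

Definition van_albada (R : realType) (dx p m : R) : R :=
  let epsL := 3 * dx in
  let epsR := 3 * dx in
  ((p ^+ 2 + epsR) * m + (m ^+ 2 + epsL) * p)
    / (m ^+ 2 + p ^+ 2 + epsL + epsR).

Definition slope (R : realType) (dx : R) (Mbar : int -> 'cV[R]_5) (i : int) :
    'cV[R]_5 :=
  \col_(k < 5) van_albada dx ((Mbar (i + 1) k 0 - Mbar i k 0) / dx)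
                             ((Mbar i k 0 - Mbar (i - 1) k 0) / dx).

(* The integer [i] also labels the interface i + 1/2 between the cells i and
   i + 1; [recon_minus] and [recon_plus] are the one-sided values there, taken
   from the cell i and from the cell i + 1 respectively. *)
Definition recon_minus (R : realType) (dx : R) (Mbar : int -> 'cV[R]_5)
    (i : int) : 'cV[R]_5 :=
  Mbar i + (dx / 2) *: slope dx Mbar i.

Definition recon_plus (R : realType) (dx : R) (Mbar : int -> 'cV[R]_5)
    (i : int) : 'cV[R]_5 :=
  Mbar (i + 1) - (dx / 2) *: slope dx Mbar (i + 1).

Definition interface_flux (R : realType) (C : moment_closure R) (dx : R)
    (Mbar : int -> 'cV[R]_5) (i : int) : 'cV[R]_5 :=
  hll_flux C (recon_minus dx Mbar i) (recon_plus dx Mbar i).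

Definition interface_speed_max (R : realType) (C : moment_closure R) (dx : R)
    (Mbar : int -> 'cV[R]_5) (i : int) : R :=
  hll_speed_max C (recon_minus dx Mbar i) (recon_plus dx Mbar i).

Definition interface_speed_min (R : realType) (C : moment_closure R) (dx : R)
    (Mbar : int -> 'cV[R]_5) (i : int) : R :=
  hll_speed_min C (recon_minus dx Mbar i) (recon_plus dx Mbar i).

Definition update (R : realType) (C : moment_closure R) (dx dt : R)
    (Mbar : int -> 'cV[R]_5) (i : int) : 'cV[R]_5 :=
  Mbar i - (dt / dx) *:
    (interface_flux C dx Mbar i - interface_flux C dx Mbar (i - 1)).

(* The grid is a set of cells [cells]: the whole of [int] for an unbounded (or
   periodic) grid, a finite interval for a bounded one, in which case the values
   of [Mbar] outside [cells] are the ghost values set by the boundary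
   conditions. *)
Definition interfaces (cells : set int) : set int :=
  [set i | cells i \/ cells (i + 1)].

(* A supremum, since the maximum need not exist on an unbounded grid. *)
Definition cfl (R : realType) (C : moment_closure R) (dx dt : R) (cells : set int)
    (Mbar : int -> 'cV[R]_5) : Prop :=
  ((dt / dx)%:E *
    ereal_sup [set (interface_speed_max C dx Mbar i
                    - interface_speed_min C dx Mbar i)%:E
              | i in interfaces cells] <= (2^-1 : R)%:E)%E.

(* Main.v *)
Require Import Defs.
From HB Require Import structures.
From mathcomp Require Import all_boot all_order all_algebra.
From mathcomp Require Import all_classical all_reals all_analysis.
From mathcomp Require Import measurable_realfun.
From mathcomp Require Import ring lra.
Import Order.TTheory GRing.Theory Num.Theory.
Import numFieldNormedType.Exports.

Set Implicit Arguments.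
Unset Strict Implicit.
Unset Printing Implicit Defensive.

Local Open Scope classical_set_scope.
Local Open Scope ring_scope.

(** The moments up to order 5 carried by either closure are those of a finite
    sum of Dirac masses whose nodes lie between the speeds delta^- and delta^+.
    For HyQMOM this is the definition.  For Gaussian-EQMOM, each Gaussian is
    replaced by its three-node Gauss-Hermite rule, with nodes v and
    v +/- sqrt 3 * sigma, which is exact up to degree 5; the condition
    a > sqrt 3 says that these nodes lie strictly between the speeds.  So a
    vector M and its flux F(M) can be written sum_j w_j phi(x_j) and
    sum_j w_j x_j phi(x_j) with w_j > 0 and phi(x) = (1, x, ..., x^4)
    ([exact_rule], [hyqmom_resolves], [geqmom_resolves]).

    Linear reconstruction makes the cell average the mean of the two interface
    values inside the cell, so the update is the sum of two half steps, one per
    interface ([update_half_steps]).  With dp and dm the HLL speeds, la = dt/dx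
    and g = 1/(dp - dm), the half step at the right interface is
      1/2 M^- - la dp g (F(M^-) - dm M^-)  +  la (- dm) g (dp M^+ - F(M^+)).
    In terms of nodes, the second part has weights la (- dm) g w_j (dp - x_j),
    nonnegative because x_j <= dp; the first has weights
    w_j (1/2 - la dp (x_j - dm) g), nonnegative because (x_j - dm) g is at
    most 1 and la dp <= la (dp - dm) <= 1/2 by the CFL condition
    ([hll_weight_ge0]).  Hence both half steps are realizable.

    Strict realizability is compared with positive definiteness of the Hankel
    matrix.  An interior point has a positive definite Hankel form
    ([strictly_realizable_hankel_pos]), hence positive leading principal minors
    ([hankel_pos_minors]); positive minors yield an explicit three-node
    representation ([hyqmom_primitive_exists]), and they define an open set, so
    they yield strict realizability
    ([hankel_minors_pos_strictly_realizable]).  The three-node representation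
    is also what shows that HyQMOM primitive variables exist at the
    reconstructed values.  For Gaussian-EQMOM the nodes are strictly inside the
    speed interval, so the first part of the right half step has positive
    weights on at least three distinct nodes and its Hankel form is positive
    definite; adding realizable vectors keeps it so. *)

(** * The cone of realizable vectors *)

Definition dirac_moments (R : realType) (x : R) : 'cV[R]_5 := \col_(k < 5) x ^+ k.

Lemma mom_dirac (R : realType) (x : R) (k : nat) :
  (k < 5)%N -> mom (dirac_moments x) k = x ^+ k.
Proof. by move=> k5; rewrite /mom mxE inordK. Qed.

Lemma momD (R : realType) (M N : 'cV[R]_5) k : mom (M + N) k = mom M k + mom N k.
Proof. by rewrite /mom mxE. Qed.

Lemma momZ (R : realType) c (M : 'cV[R]_5) k : mom (c *: M) k = c * mom M k.
Proof. by rewrite /mom mxE. Qed.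

Lemma measurable_monomial (R : realType) (k : nat) :
  measurable_fun [set: measurableTypeR R] (fun v : measurableTypeR R => (v ^+ k)%:E).
Proof. by apply/measurable_EFinP; exact: exprn_measurable. Qed.

(** A copy of the measure indexed by a finiteness proof, so that the finite
    measure structure can be attached to it. *)
Definition measure_with_finiteness d (T : measurableType d) (R : realType)
    (mu : {measure set T -> \bar R}) of fin_num_fun mu : set T -> \bar R := mu.

HB.instance Definition _ d (T : measurableType d) (R : realType)
    (mu : {measure set T -> \bar R}) (fin : fin_num_fun mu) :=
  Measure.on (measure_with_finiteness fin).

HB.instance Definition _ d (T : measurableType d) (R : realType)
    (mu : {measure set T -> \bar R}) (fin : fin_num_fun mu) :=
  Measure_isFinite.Build _ _ _ (measure_with_finiteness fin) fin.

Lemma realizable_of_measure (R : realType) (M : 'cV[R]_5)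
    (mu : {measure set (measurableTypeR R) -> \bar R}) :
  fin_num_fun mu ->
  (forall k : nat, (k < 5)%N ->
     mu.-integrable setT (fun v : measurableTypeR R => (v ^+ k)%:E) /\
     (mom M k)%:E = (\int[mu]_(v in setT) (v ^+ k)%:E)%E) ->
  realizable M.
Proof.
move=> fin muM.
by exists (measure_with_finiteness fin).
Qed.

Lemma realizableD (R : realType) (M N : 'cV[R]_5) :
  realizable M -> realizable N -> realizable (M + N).
Proof.
move=> [f fM] [g gN].
have fin : fin_num_fun (measure_add f g).
  by move=> A mA; rewrite measure_addE fin_numD !fin_num_measure.
apply: realizable_of_measure fin _.
move=> k k5; have [If Mk] := fM k k5; have [Ig Nk] := gN k k5.
have mk := @measurable_monomial R k; split => /=.
  apply/integrableP; split=> //.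
  rewrite ge0_integral_measure_add//; last exact: measurableT_comp.
  by apply: lte_add_pinfty; [case/integrableP: If|case/integrableP: Ig].
by rewrite integral_measure_add// momD EFinD Mk Nk.
Qed.

Lemma realizable_dirac (R : realType) (w x : R) :
  0 <= w -> realizable (w *: dirac_moments x).
Proof.
move=> w0; pose mu := mscale (NngNum w0) (@dirac _ (measurableTypeR R) x R).
have fin : fin_num_fun mu.
  move=> A mA; rewrite /mu /mscale/=; apply: fin_numM => //.
apply: realizable_of_measure fin _ => k k5.
have mk := @measurable_monomial R k; split => /=.
  apply/integrableP; split=> //.
  rewrite ge0_integral_mscale//; last exact: measurableT_comp.
  rewrite integral_dirac//; last exact: measurableT_comp.
  by rewrite /= diracT mul1e -EFinM ltry.
rewrite integralE ge0_integral_mscale//; last exact/measurable_funepos.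
rewrite ge0_integral_mscale//; last exact/measurable_funeneg.
rewrite integral_dirac//; last exact/measurable_funepos.
rewrite integral_dirac//; last exact/measurable_funeneg.
rewrite diracT !mul1e /= momZ mom_dirac// -muleBr//; last first.
  exact: add_def_funeposneg.
rewrite EFinM; congr (_ * _)%E.
exact: (congr1 (fun h => h x)
  (funeposneg (fun v : measurableTypeR R => (v ^+ k)%:E))).
Qed.

(** * The Hankel form *)

(** The integral against a representing measure of a polynomial of degree at
    most 4 only depends on the moments, by linearity. *)
Lemma realizable_poly_integral (R : realType) (M : 'cV[R]_5)
    (f : {finite_measure set (measurableTypeR R) -> \bar R}) (c : nat -> R) :
  (forall k : nat, (k < 5)%N ->
      f.-integrable setT (fun v : measurableTypeR R => (v ^+ k)%:E) /\
      (mom M k)%:E = (\int[f]_(v in setT) (v ^+ k)%:E)%E) ->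
  (\sum_(k < 5) c k * mom M k)%:E =
    (\int[f]_(v in setT) (\sum_(k < 5) c k * v ^+ k)%:E)%E.
Proof.
move=> fM.
under eq_integral do rewrite -sumEFin.
rewrite integral_sum//=.
  rewrite -sumEFin; apply: eq_bigr => k _.
  have [If Mk] := fM k (ltn_ord k); rewrite EFinM Mk.
  by rewrite -integralZl//; apply: eq_integral => x _; rewrite EFinM.
move=> k; have [If _] := fM k (ltn_ord k).
by under eq_fun do rewrite EFinM; exact: integrableZl.
Qed.

(** The quadratic form of the Hankel matrix at (a, b, c), that is, the value of
    the moment functional on the square of a + b X + c X^2. *)
Definition hankel_form (R : realType) (M : 'cV[R]_5) (a b c : R) : R :=
  a ^+ 2 * mom M 0 + 2 * a * b * mom M 1 + (b ^+ 2 + 2 * a * c) * mom M 2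
  + 2 * b * c * mom M 3 + c ^+ 2 * mom M 4.

Lemma hankel_form_dirac (R : realType) (x a b c : R) :
  hankel_form (dirac_moments x) a b c = (a + b * x + c * x ^+ 2) ^+ 2.
Proof. by rewrite /hankel_form !mom_dirac//; ring. Qed.

Lemma hankel_formD (R : realType) (M N : 'cV[R]_5) a b c :
  hankel_form (M + N) a b c = hankel_form M a b c + hankel_form N a b c.
Proof. by rewrite /hankel_form !momD; ring. Qed.

Lemma hankel_formZ (R : realType) (M : 'cV[R]_5) t a b c :
  hankel_form (t *: M) a b c = t * hankel_form M a b c.
Proof. by rewrite /hankel_form !momZ; ring. Qed.

(** It is the integral of a square. *)
Lemma hankel_form_ge0 (R : realType) (M : 'cV[R]_5) a b c :
  realizable M -> 0 <= hankel_form M a b c.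
Proof.
move=> [f fM].
pose e := [:: a ^+ 2; 2 * a * b; b ^+ 2 + 2 * a * c; 2 * b * c; c ^+ 2].
have := realizable_poly_integral (nth 0 e) fM.
rewrite (_ : \sum_(k < 5) _ = hankel_form M a b c); last first.
  by rewrite !big_ord_recr big_ord0/= /hankel_form; ring.
rewrite -lee_fin => ->; apply: integral_ge0 => v _; rewrite lee_fin.
rewrite (_ : \sum_(k < 5) _ = (a + b * v + c * v ^+ 2) ^+ 2) ?sqr_ge0//.
by rewrite !big_ord_recr big_ord0/=; ring.
Qed.

Definition hankel_pos (R : realType) (M : 'cV[R]_5) : Prop :=
  forall a b c, (a, b, c) != (0, 0, 0) -> 0 < hankel_form M a b c.

(** Divided differences: each difference of two values is divisible by the
    difference of the nodes, which kills c, then b, then a. *)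
Lemma quadratic_three_roots (R : realType) (x y z a b c : R) :
  x != y -> y != z -> x != z ->
  a + b * x + c * x ^+ 2 = 0 -> a + b * y + c * y ^+ 2 = 0 ->
  a + b * z + c * z ^+ 2 = 0 -> (a, b, c) = (0, 0, 0).
Proof.
rewrite -subr_eq0 => xy; rewrite -subr_eq0 => yz; rewrite -subr_eq0 => xz.
move=> px py pz.
have bxy : b + c * (x + y) = 0.
  by apply: (mulfI xy); rewrite mulr0 -[RHS](subrr 0) -{1}px -py; ring.
have byz : b + c * (y + z) = 0.
  by apply: (mulfI yz); rewrite mulr0 -[RHS](subrr 0) -{1}py -pz; ring.
have c0 : c = 0.
  by apply: (mulfI xz); rewrite mulr0 -[RHS](subrr 0) -{1}bxy -byz; ring.
move: bxy px; rewrite c0 !mul0r !addr0 => -> /eqP.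
by rewrite mul0r addr0 => /eqP ->.
Qed.

(** A vector in the interior stays realizable after removing a small Dirac mass
    at a point x where the polynomial a + b X + c X^2 does not vanish; the form
    is nonnegative on what remains and positive on the mass removed. *)
Lemma strictly_realizable_hankel_pos (R : realType) (M : 'cV[R]_5) :
  strictly_realizable M -> hankel_pos M.
Proof.
move=> Mint a b c abc.
have [x px] : exists x, a + b * x + c * x ^+ 2 != 0.
  apply: contrapT => nx.
  have root x : a + b * x + c * x ^+ 2 = 0.
    by apply: contrapT => /eqP px; apply: nx; exists x.
  move/negP: abc; apply; apply/eqP.
  by apply: (@quadratic_three_roots _ 0 1 2) => //; rewrite lt_eqF//; lra.
have toM : (fun t : R => M - t *: dirac_moments x) t @[t --> (0 : R)^'+] --> M.
  rewrite -[X in _ --> X]subr0 -[X in _ - X](scale0r (dirac_moments x)).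
  apply: cvgB; first exact: cvg_cst.
  apply: cvg_at_right_filter.
  exact: (@scalel_continuous R 'cV[R]_5 (dirac_moments x) 0).
have [t [t0 tM]] : exists t : R, 0 < t /\ realizable (M - t *: dirac_moments x).
  have : \forall t \near (0 : R)^'+, 0 < t /\ realizable (M - t *: dirac_moments x).
    by near=> t; split; [near: t; exact: nbhs_right_gt|near: t; exact: (toM _ Mint)].
  by move/(@filter_ex _ _ _ _).
rewrite -[M](subrK (t *: dirac_moments x)) hankel_formD hankel_formZ hankel_form_dirac.
rewrite ltr_wpDl ?hankel_form_ge0// mulr_gt0//.
by rewrite lt_def sqr_ge0 sqrf_eq0 px.
Unshelve. all: by end_near. Qed.

(** * Hankel minors and three-point representations *)

Definition hankel_minor2 (R : realType) (M : 'cV[R]_5) : R :=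
  mom M 0 * mom M 2 - mom M 1 ^+ 2.

Definition hankel_det (R : realType) (M : 'cV[R]_5) : R :=
  mom M 0 * mom M 2 * mom M 4 + 2 * mom M 1 * mom M 2 * mom M 3
  - mom M 2 ^+ 3 - mom M 0 * mom M 3 ^+ 2 - mom M 1 ^+ 2 * mom M 4.

Definition hankel_minors_pos (R : realType) (M : 'cV[R]_5) : Prop :=
  [/\ 0 < mom M 0, 0 < hankel_minor2 M & 0 < hankel_det M].

(** Each minor is read off by evaluating the form at the last column of the
    adjugate of the corresponding leading block: the value is the minor times
    the preceding one. *)
Lemma hankel_pos_minors (R : realType) (M : 'cV[R]_5) :
  hankel_pos M -> hankel_minors_pos M.
Proof.
move=> posM.
have M0 : 0 < mom M 0.
  have := posM 1 0 0; rewrite !xpair_eqE oner_eq0 => /(_ isT).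
  by rewrite /hankel_form; lra.
have minor2 : 0 < hankel_minor2 M.
  have := posM (- mom M 1) (mom M 0) 0; rewrite !xpair_eqE (gt_eqF M0) andbF.
  move=> /(_ isT); rewrite (_ : hankel_form _ _ _ _ = mom M 0 * hankel_minor2 M).
    by rewrite pmulr_rgt0.
  by rewrite /hankel_form /hankel_minor2; ring.
split=> //.
have := posM (mom M 1 * mom M 3 - mom M 2 ^+ 2)
  (mom M 1 * mom M 2 - mom M 0 * mom M 3) (hankel_minor2 M).
rewrite !xpair_eqE (gt_eqF minor2) andbF => /(_ isT).
rewrite (_ : hankel_form _ _ _ _ = hankel_minor2 M * hankel_det M).
  by rewrite pmulr_rgt0.
by rewrite /hankel_form /hankel_minor2 /hankel_det; ring.
Qed.

(** A rule with nodes x1, 0, x3 for the centered normalized moments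
    (1, 0, c2, c3, c4).  The moment equations determine the sum s = c3 / c2 of
    the outer nodes and q = - x1 x3 = c4 / c2 - s^2.  The determinant condition
    is c2 < q, which makes the outer nodes real with opposite signs and the
    central weight 1 - c2 / q positive. *)
Lemma three_point_quadrature (R : realType) (c2 c3 c4 : R) :
  0 < c2 -> c2 ^+ 3 + c3 ^+ 2 < c2 * c4 ->
  exists w1 w2 w3 x1 x3 : R,
    [/\ 0 < w1, 0 < w2 & 0 < w3] /\
    [/\ w1 + w2 + w3 = 1, w1 * x1 + w3 * x3 = 0,
        w1 * x1 ^+ 2 + w3 * x3 ^+ 2 = c2, w1 * x1 ^+ 3 + w3 * x3 ^+ 3 = c3 &
        w1 * x1 ^+ 4 + w3 * x3 ^+ 4 = c4].
Proof.
move=> c2_gt0 det_gt0; have c2_neq0 : c2 != 0 by rewrite gt_eqF.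
pose s := c3 / c2; pose q := c4 / c2 - s ^+ 2.
have c3E : c3 = s * c2 by rewrite /s divfK.
have c4E : c4 = (q + s ^+ 2) * c2 by rewrite /q subrK divfK.
have c2_lt_q : c2 < q.
  rewrite -(ltr_pM2l (exprn_gt0 2 c2_gt0)).
  by move: det_gt0; rewrite c3E c4E; lra.
have q_gt0 : 0 < q by apply: lt_trans c2_lt_q.
pose r := Num.sqrt (s ^+ 2 + 4 * q).
have disc_gt0 : 0 < s ^+ 2 + 4 * q by have := sqr_ge0 s; lra.
have r_gt0 : 0 < r by rewrite sqrtr_gt0.
have r2 : r ^+ 2 = s ^+ 2 + 4 * q by rewrite sqr_sqrtr// ltW.
have /andP[sNr srr] : - r < s < r.
  by rewrite -ltr_norml -(ltr_pXn2r (n := 2)) ?nnegrE ?normr_ge0 ?(ltW r_gt0)//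
    real_normK ?num_real// r2; lra.
(* The outer nodes are the roots - x and y of X^2 - s X - q. *)
pose x := (r - s) / 2; pose y := (r + s) / 2.
have x_gt0 : 0 < x by rewrite /x; lra.
have y_gt0 : 0 < y by rewrite /y; lra.
have sE : s = y - x by rewrite /x /y; field.
have qE : q = x * y.
  by apply: (@mulfI _ 4) => //; rewrite /x /y; move: r2; clear; lra.
have xy_gt0 : 0 < x + y by rewrite addr_gt0.
have x0 : x != 0 by rewrite gt_eqF.
have y0 : y != 0 by rewrite gt_eqF.
have xy0 : x + y != 0 by rewrite gt_eqF.
exists (c2 / (x * (x + y))), (1 - c2 / q), (c2 / (y * (x + y))), (- x), y.
split; first split.
- by rewrite divr_gt0// mulr_gt0.
- by rewrite subr_gt0 ltr_pdivrMr// mul1r.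
- by rewrite divr_gt0// mulr_gt0.
by rewrite c3E c4E sE qE; split; field; rewrite ?x0 ?y0 ?xy0.
Qed.

(** After normalizing and centering at the mean u, the three-point rule applies;
    translating it back by u puts its central node at M_1 / M_0. *)
Lemma hyqmom_primitive_exists (R : realType) (M : 'cV[R]_5) :
  hankel_minors_pos M -> exists p, hyqmom_primitive M p.
Proof.
case; rewrite /hankel_minor2 /hankel_det; set m := mom M 0 => m_gt0.
have m0 : m != 0 by rewrite gt_eqF.
(* u is the mean; c2, c3, c4 are the normalized central moments. *)
pose u := mom M 1 / m; pose c2 := mom M 2 / m - u ^+ 2.
pose c3 := mom M 3 / m - 3 * u * c2 - u ^+ 3.
pose c4 := mom M 4 / m - 4 * u * c3 - 6 * u ^+ 2 * c2 - u ^+ 4.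
have M1 : mom M 1 = m * u by rewrite /u; field.
have M2 : mom M 2 = m * (c2 + u ^+ 2) by rewrite /c2; field.
have M3 : mom M 3 = m * (c3 + 3 * u * c2 + u ^+ 3) by rewrite /c3; field.
have M4 : mom M 4 = m * (c4 + 4 * u * c3 + 6 * u ^+ 2 * c2 + u ^+ 4).
  by rewrite /c4; field.
rewrite M2 M3 M4 M1 => minor2 det.
have c2_gt0 : 0 < c2.
  by rewrite -(pmulr_rgt0 _ (exprn_gt0 2 m_gt0)); move: minor2; lra.
have det_gt0 : c2 ^+ 3 + c3 ^+ 2 < c2 * c4.
  by rewrite -(ltr_pM2l (exprn_gt0 3 m_gt0)); move: det; lra.
have [w1 [w2 [w3 [x1 [x3 [[w1p w2p w3p] [e0 e1 e2 e3 e4]]]]]]] :=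
  three_point_quadrature c2_gt0 det_gt0.
exists (m * w1, u + x1, m * w2, u, m * w3, u + x3).
split; rewrite ?mulr_gt0//.
pose S k := w1 * x1 ^+ k + w3 * x3 ^+ k.
case=> [|[|[|[|[|//]]]]] _.
- transitivity (m * (w1 + w2 + w3)); last by ring.
  by rewrite e0 mulr1.
- transitivity (m * (u * (w1 + w2 + w3) + (w1 * x1 + w3 * x3))); last by ring.
  by rewrite e0 e1 M1; ring.
- transitivity (m * (u ^+ 2 * (w1 + w2 + w3) + 2 * u * (w1 * x1 + w3 * x3) + S 2));
    last by rewrite /S; ring.
  by rewrite /S e0 e1 e2 M2; ring.
- transitivity (m * (u ^+ 3 * (w1 + w2 + w3) + 3 * u ^+ 2 * (w1 * x1 + w3 * x3)
    + 3 * u * S 2 + S 3)); last by rewrite /S; ring.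
  by rewrite /S e0 e1 e2 e3 M3; ring.
- transitivity (m * (u ^+ 4 * (w1 + w2 + w3) + 4 * u ^+ 3 * (w1 * x1 + w3 * x3)
    + 6 * u ^+ 2 * S 2 + 4 * u * S 3 + S 4)); last by rewrite /S; ring.
  by rewrite /S e0 e1 e2 e3 e4 M4; ring.
Qed.

Lemma hyqmom_primitive_realizable (R : realType) (M : 'cV[R]_5) p :
  hyqmom_primitive M p -> realizable M.
Proof.
case: p => [[[[[w1 x1] w2] x2] w3] x3] [w1_gt0 w2_gt0 w3_gt0 _ ME].
have -> : M = w1 *: dirac_moments x1 + w2 *: dirac_moments x2 + w3 *: dirac_moments x3.
  apply/colP => k; have := ME k (ltn_ord k).
  by rewrite /mom inord_val => ->; rewrite !mxE.
by apply: realizableD; [apply: realizableD|]; apply: realizable_dirac; exact: ltW.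
Qed.

(** The minors depend continuously on the vector, so their positivity holds on a
    neighbourhood, and each vector there is a sum of three Dirac masses. *)
Lemma hankel_minors_pos_strictly_realizable (R : realType) (M : 'cV[R]_5) :
  hankel_minors_pos M -> strictly_realizable M.
Proof.
case=> m_gt0 minor2_gt0 det_gt0.
have momC k : mom N k @[N --> M] --> mom M k by exact: coord_continuous.
have momX k n : mom N k ^+ n @[N --> M] --> mom M k ^+ n.
  exact: (cvg_comp _ _ (momC k) (@exprn_continuous R n _)).
have FF : Filter (nbhs M) := nbhs_filter M.
have minor2C : hankel_minor2 N @[N --> M] --> hankel_minor2 M.
  exact: (cvgB (cvgM (momC 0%N) (momC 2)) (momX 1 2)).
have detC : hankel_det N @[N --> M] --> hankel_det M.
  have two : (2 : R) @[N --> M] --> (2 : R) by exact: cvg_cst.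
  exact: (cvgB (cvgB (cvgB (cvgD
      (cvgM (cvgM (momC 0%N) (momC 2)) (momC 4))
      (cvgM (cvgM (cvgM two (momC 1)) (momC 2)) (momC 3)))
    (momX 2 3)) (cvgM (momC 0%N) (momX 3 2))) (cvgM (momX 1 2) (momC 4))).
rewrite /strictly_realizable /interior /=.
have : \forall N \near M, hankel_minors_pos N.
  near=> N; split; near: N.
  - exact: (cvgr_gt _ (momC 0%N)).
  - exact: (cvgr_gt _ minor2C).
  - exact: (cvgr_gt _ detC).
apply: filterS => N /hyqmom_primitive_exists[p].
exact: hyqmom_primitive_realizable.
Unshelve. all: by end_near. Qed.

(** * Finite sums of Dirac masses matching a vector and its flux *)

(** A finite sum of Dirac masses, listed as pairs (weight, node), with moments M
    of orders 0 to 4 and F of orders 1 to 5. *)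
Definition exact_rule (R : realType) (M F : 'cV[R]_5) (s : seq (R * R)) : Prop :=
  [/\ forall p, p \in s -> 0 < p.1,
      M = \sum_(p <- s) p.1 *: dirac_moments p.2
    & F = \sum_(p <- s) (p.1 * p.2) *: dirac_moments p.2].

(** Combining M and F linearly multiplies the underlying measure by an affine
    function of the node. *)
Lemma exact_rule_affine (R : realType) (M F : 'cV[R]_5) s (c0 c1 : R) :
  exact_rule M F s ->
  c0 *: M + c1 *: F = \sum_(p <- s) (p.1 * (c0 + c1 * p.2)) *: dirac_moments p.2.
Proof.
move=> [_ -> ->]; rewrite !scaler_sumr -big_split/=.
apply: eq_bigr => p _; rewrite !scalerA -scalerDl; congr (_ *: _); ring.
Qed.

Lemma exact_rule_realizable (R : realType) (M F : 'cV[R]_5) s (c0 c1 : R) :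
  exact_rule M F s -> (forall p, p \in s -> 0 <= c0 + c1 * p.2) ->
  realizable (c0 *: M + c1 *: F).
Proof.
move=> rule c_ge0; rewrite (exact_rule_affine _ _ rule).
have [w_gt0 _ _] := rule; rewrite big_seq.
apply: (big_ind (@realizable R)) => [||p ps].
- by rewrite -(scale0r (dirac_moments 0)); exact: realizable_dirac.
- exact: realizableD.
- by apply: realizable_dirac; rewrite mulr_ge0 ?c_ge0// ltW ?w_gt0.
Qed.

(** A nonzero polynomial of degree at most 2 cannot vanish at three distinct
    nodes, so the integral of its square has a positive term. *)
Lemma exact_rule_hankel_pos (R : realType) (M F : 'cV[R]_5) s (c0 c1 x y z : R) :
  exact_rule M F s -> (forall p, p \in s -> 0 < c0 + c1 * p.2) ->
  uniq [:: x; y; z] -> {subset [:: x; y; z] <= [seq p.2 | p <- s]} ->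
  hankel_pos (c0 *: M + c1 *: F).
Proof.
move=> rule c_gt0 + sub a b c abc; rewrite /= !inE negb_or => /and3P[/andP[xy xz] yz _].
have [w_gt0 _ _] := rule.
rewrite (exact_rule_affine _ _ rule).
rewrite (big_morph (fun N => hankel_form N a b c) (id1 := 0)
  (fun _ _ => hankel_formD _ _ _ _ _)); last by rewrite /hankel_form /mom !mxE; ring.
have [p ps qp] : exists2 p, p \in s & a + b * p.2 + c * p.2 ^+ 2 != 0.
  have [t ts qt] : exists2 t, t \in [:: x; y; z] & a + b * t + c * t ^+ 2 != 0.
    apply/hasP; apply: contraR abc => /hasPn q0; apply/eqP.
    apply: (@quadratic_three_roots _ x y z) => //; apply/eqP.
    - by apply: negbNE; apply: q0; rewrite !inE eqxx.
    - by apply: negbNE; apply: q0; rewrite !inE eqxx ?orbT.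
    - by apply: negbNE; apply: q0; rewrite !inE eqxx ?orbT.
  by have /mapP[p ps tE] := sub _ ts; exists p; rewrite // -tE.
have term_ge0 (r : R * R) : r \in s ->
    0 <= hankel_form ((r.1 * (c0 + c1 * r.2)) *: dirac_moments r.2) a b c.
  move=> rs; rewrite hankel_formZ hankel_form_dirac mulr_ge0 ?sqr_ge0//.
  by rewrite mulr_ge0// ltW ?w_gt0 ?c_gt0.
rewrite (big_rem p)//= ltr_pwDl//.
  rewrite hankel_formZ hankel_form_dirac.
  apply: mulr_gt0; first by rewrite mulr_gt0 ?w_gt0 ?c_gt0.
  by rewrite lt_def sqr_ge0 sqrf_eq0 qp.
by rewrite big_seq sumr_ge0// => r /mem_rem; exact: term_ge0.
Qed.

(** * The HLL half steps *)

(** The quotient lies in [0, 1] and la * dp <= la * (dp - dm) since dm <= 0.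
    When dp = dm the quotient is 0, as division by 0 is. *)
Lemma hll_weight_ge0 (R : realFieldType) (la dm dp x : R) :
  0 <= la -> dm <= 0 <= dp -> la * (dp - dm) <= 2^-1 -> dm <= x <= dp ->
  0 <= 2^-1 - la * dp * ((x - dm) / (dp - dm)).
Proof.
move=> la_ge0 /andP[dm_le0 dp_ge0] cfl /andP[dm_le_x x_le_dp].
have [dpm|dpm] := leP dp dm.
  have -> : x - dm = 0 by lra.
  by rewrite mul0r mulr0 subr0 invr_ge0.
have t_le1 : (x - dm) / (dp - dm) <= 1.
  by rewrite ler_pdivrMr ?subr_gt0// mul1r; lra.
rewrite subr_ge0 (le_trans _ cfl)//.
rewrite (le_trans (ler_wpM2l (mulr_ge0 la_ge0 dp_ge0) t_le1))// mulr1.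
by rewrite ler_wpM2l//; lra.
Qed.

(** The quotient is now less than 1, which makes the bound strict when dp > 0; if
    dp = 0 the subtracted term vanishes. *)
Lemma hll_weight_gt0 (R : realFieldType) (la dm dp x : R) :
  0 < la -> dm <= 0 <= dp -> la * (dp - dm) <= 2^-1 -> dm < x < dp ->
  0 < 2^-1 - la * dp * ((x - dm) / (dp - dm)).
Proof.
move=> la_gt0 /andP[dm_le0 dp_ge0] cfl /andP[dm_lt_x x_lt_dp].
have dpm : dm < dp by apply: lt_trans x_lt_dp.
have t_lt1 : (x - dm) / (dp - dm) < 1.
  by rewrite ltr_pdivrMr ?subr_gt0// mul1r; lra.
move: dp_ge0; rewrite le_eqVlt => /predU1P[<-|dp_gt0].
  by rewrite mulr0 mul0r subr0 invr_gt0.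
rewrite subr_gt0 (lt_le_trans _ cfl)// -subr_gt0.
have ladp : 0 < la * dp by rewrite mulr_gt0.
have := ltr_pM2l ladp ((x - dm) / (dp - dm)) 1; rewrite t_lt1 mulr1 => ?.
have : la * dp <= la * (dp - dm) by rewrite ler_pM2l//; lra.
lra.
Qed.

(** What a closure needs for its HLL scheme to preserve realizability: the flux
    comes from Dirac masses moving at velocities allowed by the speeds. *)
Definition resolves (R : realType) (C : moment_closure R) (M : 'cV[R]_5)
    (s : seq (R * R)) : Prop :=
  [/\ exact_rule M (flux C M) s,
      speed_min C M <= 0 <= speed_max C M
    & forall p, p \in s -> speed_min C M <= p.2 <= speed_max C M].

Section HLLHalfSteps.
Context (R : realType) (C : moment_closure R) (la : R) (Mm Mp : 'cV[R]_5).
Context (sm sp : seq (R * R)).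
Let dp := hll_speed_max C Mm Mp.
Let dm := hll_speed_min C Mm Mp.
Let g := (dp - dm)^-1.
Hypotheses (la_gt0 : 0 < la) (cfl : la * (dp - dm) <= 2^-1).
Hypotheses (Rm : resolves C Mm sm) (Rp : resolves C Mp sp).

Let dm_le0_dp : dm <= 0 <= dp.
Proof.
have [_ /andP[m1 m2] _] := Rm; have [_ /andP[p1 p2] _] := Rp.
by rewrite /dm /dp /hll_speed_min /hll_speed_max ge_min p1/= le_max p2.
Qed.

Let g_ge0 : 0 <= g.
Proof. by have /andP[? ?] := dm_le0_dp; rewrite invr_ge0; lra. Qed.

Let nodes_m p : p \in sm -> dm <= p.2 <= dp.
Proof.
have [_ _ bnd] := Rm => /bnd /andP[lo hi].
by rewrite /dm /dp /hll_speed_min /hll_speed_max ge_min lo orbT le_max hi orbT.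
Qed.

Let nodes_p p : p \in sp -> dm <= p.2 <= dp.
Proof.
have [_ _ bnd] := Rp => /bnd /andP[lo hi].
by rewrite /dm /dp /hll_speed_min /hll_speed_max ge_min lo le_max hi.
Qed.

(** Separates the mass that starts in the cell on the left of the interface from
    the mass that enters it through the interface. *)
Lemma hll_half_step_m :
  2^-1 *: Mm - la *: hll_flux C Mm Mp =
    ((2^-1 + la * dp * dm * g) *: Mm + (- (la * dp * g)) *: flux C Mm)
    + ((- (la * dp * dm * g)) *: Mp + (la * dm * g) *: flux C Mp).
Proof.
by apply/colP => k; rewrite /hll_flux -/dp -/dm -/g !mxE; ring.
Qed.

(** The mirror image, for the cell on the right of the interface. *)
Lemma hll_half_step_p :
  2^-1 *: Mp + la *: hll_flux C Mm Mp =
    ((2^-1 + la * dp * dm * g) *: Mp + (- (la * dm * g)) *: flux C Mp)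
    + ((- (la * dp * dm * g)) *: Mm + (la * dp * g) *: flux C Mm).
Proof.
by apply/colP => k; rewrite /hll_flux -/dp -/dm -/g !mxE; ring.
Qed.

Lemma hll_incoming_p_realizable :
  realizable ((- (la * dp * dm * g)) *: Mp + (la * dm * g) *: flux C Mp).
Proof.
have [rule _ _] := Rp; apply: (exact_rule_realizable rule) => p /nodes_p /andP[_ hi].
rewrite (_ : _ + _ * p.2 = la * g * (- dm) * (dp - p.2)); last by ring.
have /andP[? _] := dm_le0_dp.
by rewrite !mulr_ge0 ?g_ge0 ?(ltW la_gt0)//; lra.
Qed.

Lemma hll_incoming_m_realizable :
  realizable ((- (la * dp * dm * g)) *: Mm + (la * dp * g) *: flux C Mm).
Proof.
have [rule _ _] := Rm; apply: (exact_rule_realizable rule) => p /nodes_m /andP[lo _].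
rewrite (_ : _ + _ * p.2 = la * g * dp * (p.2 - dm)); last by ring.
have /andP[_ ?] := dm_le0_dp.
by rewrite !mulr_ge0 ?g_ge0 ?(ltW la_gt0)//; lra.
Qed.

Lemma hll_half_step_m_realizable : realizable (2^-1 *: Mm - la *: hll_flux C Mm Mp).
Proof.
rewrite hll_half_step_m; apply: realizableD hll_incoming_p_realizable.
have [rule _ _] := Rm; apply: (exact_rule_realizable rule) => p /nodes_m bnd.
rewrite (_ : _ + _ * p.2 = 2^-1 - la * dp * ((p.2 - dm) * g)); last by ring.
by apply: hll_weight_ge0 => //; exact: ltW.
Qed.

(** Reversing the direction of the axis exchanges (dm, dp, x) with
    (- dp, - dm, - x) and reduces to the weights of the left cell. *)
Lemma hll_half_step_p_realizable : realizable (2^-1 *: Mp + la *: hll_flux C Mm Mp).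
Proof.
rewrite hll_half_step_p; apply: realizableD hll_incoming_m_realizable.
have [rule _ _] := Rp; apply: (exact_rule_realizable rule) => p /nodes_p /andP[lo hi].
have /andP[dm_le0 dp_ge0] := dm_le0_dp.
have widthE : - dm - - dp = dp - dm by ring.
rewrite (_ : _ + _ * p.2 = 2^-1 - la * (- dm) * ((- p.2 - - dp) / (- dm - - dp))).
  apply: hll_weight_ge0; first exact: ltW.
  - by rewrite oppr_le0 oppr_ge0 dp_ge0.
  - by rewrite widthE.
  - by rewrite !lerN2 hi.
rewrite widthE -/g; ring.
Qed.

(** The mass that stays in the cell has positive weights at all its nodes; the
    mass that enters only adds a nonnegative form. *)
Lemma hll_half_step_m_hankel_pos x y z :
  (forall p, p \in sm -> speed_min C Mm < p.2 < speed_max C Mm) ->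
  uniq [:: x; y; z] -> {subset [:: x; y; z] <= [seq p.2 | p <- sm]} ->
  hankel_pos (2^-1 *: Mm - la *: hll_flux C Mm Mp).
Proof.
move=> strict xyz sub a b c abc; rewrite hll_half_step_m hankel_formD.
rewrite ltr_pwDl ?hankel_form_ge0//; last exact: hll_incoming_p_realizable.
have [rule _ _] := Rm.
apply: (exact_rule_hankel_pos rule _ xyz sub) abc => p /strict /andP[lo hi].
rewrite (_ : _ + _ * p.2 = 2^-1 - la * dp * ((p.2 - dm) * g)); last by ring.
apply: hll_weight_gt0 => //.
by rewrite /dm /dp /hll_speed_min /hll_speed_max gt_min lo orbT lt_max hi orbT.
Qed.

End HLLHalfSteps.

(** * The two closures *)

Lemma hyqmom_resolves (R : realType) (M : 'cV[R]_5) :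
  strictly_realizable M -> exists s, resolves (hyqmom R) M s.
Proof.
move=> /strictly_realizable_hankel_pos /hankel_pos_minors.
move=> /hyqmom_primitive_exists primM.
have : hyqmom_primitive M (hyqmom_prim M) by exact: xgetPex.
case pE : (hyqmom_prim M) => [[[[[w1 x1] w2] x2] w3] x3].
move=> [w1_gt0 w2_gt0 w3_gt0 _ ME].
exists [:: (w1, x1); (w2, x2); (w3, x3)]; split.
- split.
  + by move=> p; rewrite !inE => /or3P[] /eqP->.
  + apply/colP => k; have := ME k (ltn_ord k).
    by rewrite /mom inord_val => ->; rewrite !big_cons big_nil !mxE addr0 addrA.
  + rewrite /flux /= pE !big_cons big_nil.
    apply/colP => -[[|[|[|[|[|//]]]]] lt]; rewrite !mxE /= ?ME//; ring.
- by rewrite /= pE ge_min le_max lexx !orbT.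
- move=> p; rewrite !inE /= pE.
  by case/or3P => /eqP-> /=; rewrite !ge_min !le_max lexx ?orbT.
Qed.

(** The three-node Gauss-Hermite rule for the standard Gaussian has nodes 0 and
    +/- sqrt 3 with weights 2/3 and 1/6; it is used here for both Gaussians. *)
Definition gauss_hermite_rule (R : realType) (p : R * R * R * R * R) :
    seq (R * R) :=
  let: (w1, v1, w2, v2, sigma) := p in
  let h := Num.sqrt 3 * sigma in
  [:: (2 / 3 * w1, v1); (w1 / 6, v1 - h); (w1 / 6, v1 + h);
      (2 / 3 * w2, v2); (w2 / 6, v2 - h); (w2 / 6, v2 + h)].

Lemma geqmom_primP (R : realType) (M : 'cV[R]_5) :
  geqmom_admissible M -> geqmom_primitive M (geqmom_prim M).
Proof. by move=> admM; exact: xgetPex. Qed.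

(** Exactness in degree 5 is what makes the closure value of M_5 agree with the
    fifth moment of the rule. *)
Lemma gauss_hermite_exact (R : realType) (a : R) (M : 'cV[R]_5) :
  geqmom_admissible M ->
  exact_rule M (flux (geqmom a) M) (gauss_hermite_rule (geqmom_prim M)).
Proof.
move=> /geqmom_primP; rewrite /flux /=.
case: (geqmom_prim M) => [[[[w1 v1] w2] v2] s] [[w1_gt0 w2_gt0 s_gt0]].
move=> [M0 M1 M2 M3 M4].
have [h hE] : exists h : R, h = Num.sqrt 3 * s by eexists.
rewrite /gauss_hermite_rule -hE.
have s2E : s ^+ 2 = h ^+ 2 / 3.
  by rewrite hE exprMn sqr_sqrtr ?ler0n//; field.
have s4E : s ^+ 4 = h ^+ 4 / 9.
  by rewrite (exprM s 2 2) s2E; field.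
have momE k (lt : (k < 5)%N) : M (Ordinal lt) 0 = mom M k.
  by rewrite /mom; congr (M _ _); apply: val_inj; rewrite /= inordK.
split.
- move=> p; rewrite !inE.
  by do ![case/orP] => /eqP-> /=; rewrite ?divr_gt0 ?mulr_gt0.
- rewrite !big_cons big_nil.
  apply/colP => -[[|[|[|[|[|//]]]]] lt]; rewrite momE !mxE /=.
  + by rewrite M0; field.
  + by rewrite M1; field.
  + by rewrite M2 M0 s2E; field.
  + by rewrite M3 M1 s2E; field.
  + by rewrite M4 M2 M0 s4E s2E; field.
- rewrite !big_cons big_nil.
  apply/colP => -[[|[|[|[|[|//]]]]] lt]; rewrite !mxE /=.
  + by rewrite M1; field.
  + by rewrite M2 M0 s2E; field.
  + by rewrite M3 M1 s2E; field.
  + by rewrite M4 M2 M0 s4E s2E; field.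
  + by rewrite M3 M1 s4E s2E; field.
Qed.

Lemma gauss_hermite_nodes (R : realType) (a : R) (M : 'cV[R]_5) p :
  Num.sqrt 3 < a -> geqmom_admissible M ->
  p \in gauss_hermite_rule (geqmom_prim M) ->
  speed_min (geqmom a) M < p.2 < speed_max (geqmom a) M.
Proof.
move=> a_gt /geqmom_primP /=.
case: (geqmom_prim M) => [[[[w1 v1] w2] v2] s] [[_ _ s_gt0]] _.
have h_lt : Num.sqrt 3 * s < a * s by rewrite ltr_pM2r.
have h_gt0 : 0 < Num.sqrt 3 * s by rewrite mulr_gt0// sqrtr_gt0.
have near1 x : v1 - a * s < x < v1 + a * s ->
    Num.min (Num.min (v1 - a * s) (v2 - a * s)) 0 < x <
    Num.max (Num.max (v1 + a * s) (v2 + a * s)) 0.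
  by move=> /andP[lo hi]; rewrite !gt_min !lt_max lo hi.
have near2 x : v2 - a * s < x < v2 + a * s ->
    Num.min (Num.min (v1 - a * s) (v2 - a * s)) 0 < x <
    Num.max (Num.max (v1 + a * s) (v2 + a * s)) 0.
  by move=> /andP[lo hi]; rewrite !gt_min !lt_max lo hi !orbT.
rewrite !inE => /or4P[/eqP->|/eqP->|/eqP->|/or3P[] /eqP->] /=.
all: by [apply: near1; lra|apply: near2; lra].
Qed.

Lemma geqmom_resolves (R : realType) (a : R) (M : 'cV[R]_5) :
  Num.sqrt 3 < a -> geqmom_admissible M ->
  resolves (geqmom a) M (gauss_hermite_rule (geqmom_prim M)).
Proof.
move=> a_gt admM; split; first exact: gauss_hermite_exact.
- rewrite /=; case: (geqmom_prim M) => [[[[w1 v1] w2] v2] s].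
  by rewrite ge_min le_max lexx !orbT.
- move=> p /(gauss_hermite_nodes a_gt admM) /andP[lo hi].
  by rewrite !ltW.
Qed.

(** The first Gaussian alone provides three distinct nodes. *)
Lemma geqmom_half_step_hankel_pos (R : realType) (a la : R) (Mm Mp : 'cV[R]_5) :
  Num.sqrt 3 < a -> geqmom_admissible Mm -> geqmom_admissible Mp -> 0 < la ->
  la * (hll_speed_max (geqmom a) Mm Mp - hll_speed_min (geqmom a) Mm Mp)
    <= 2^-1 ->
  hankel_pos (2^-1 *: Mm - la *: hll_flux (geqmom a) Mm Mp).
Proof.
move=> a_gt admm admp la_gt0 cfl.
have Rm := geqmom_resolves a_gt admm; have Rp := geqmom_resolves a_gt admp.
have strict p := @gauss_hermite_nodes R a Mm p a_gt admm.
have [x [y [z [xyz sub]]]] : exists x y z, uniq [:: x; y; z] /\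
    {subset [:: x; y; z] <= [seq p.2 | p <- gauss_hermite_rule (geqmom_prim Mm)]}.
  have := geqmom_primP admm.
  case: (geqmom_prim Mm) => [[[[w1 v1] w2] v2] s] [[_ _ s_gt0]] _.
  have h_gt0 : 0 < Num.sqrt 3 * s by rewrite mulr_gt0// sqrtr_gt0.
  exists (v1 - Num.sqrt 3 * s), v1, (v1 + Num.sqrt 3 * s); split.
    by rewrite /= !inE negb_or !lt_eqF//; lra.
  by move=> x; rewrite !inE => /or3P[] /eqP->; rewrite eqxx ?orbT.
exact: (hll_half_step_m_hankel_pos la_gt0 cfl Rm Rp strict xyz sub).
Qed.

(** * The scheme *)

Lemma cfl_interface (R : realType) (C : moment_closure R) (dx dt : R)
    (cells : set int) (Mbar : int -> 'cV[R]_5) (i : int) :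
  0 < dt / dx -> cfl C dx dt cells Mbar -> interfaces cells i ->
  dt / dx * (interface_speed_max C dx Mbar i - interface_speed_min C dx Mbar i)
    <= 2^-1.
Proof.
move=> la_gt0 cflP cell_i; rewrite -lee_fin EFinM; apply: le_trans cflP.
rewrite lee_pmul2l// ?lte_fin//.
by apply: ereal_sup_ubound; exists i.
Qed.

(** The slopes cancel in the mean of the two reconstructed values of a cell. *)
Lemma update_half_steps (R : realType) (C : moment_closure R) (dx dt : R)
    (Mbar : int -> 'cV[R]_5) (i : int) :
  update C dx dt Mbar i =
    (2^-1 *: recon_minus dx Mbar i - (dt / dx) *: interface_flux C dx Mbar i)
    + (2^-1 *: recon_plus dx Mbar (i - 1)
       + (dt / dx) *: interface_flux C dx Mbar (i - 1)).
Proof.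
rewrite [RHS]addrACA /update scalerBr opprB; congr (_ + _); last by rewrite addrC.
rewrite /recon_minus /recon_plus subrK -scalerDr addrACA subrr addr0.
by rewrite scalerDr -scalerDl -div1r -splitr scale1r.
Qed.

Theorem theorem3p5 (R : realType) (dx dt : R) (cells : set int)
    (Mbar : int -> 'cV[R]_5) :
  0 < dx -> 0 < dt ->
  (forall i : int, cells i -> strictly_realizable (Mbar i)) ->
  (forall i : int, interfaces cells i ->
     strictly_realizable (recon_minus dx Mbar i) /\
     strictly_realizable (recon_plus dx Mbar i)) ->
  (forall a : R, Num.sqrt 3 < a ->
     (forall i : int, interfaces cells i ->
        geqmom_admissible (recon_minus dx Mbar i) /\
        geqmom_admissible (recon_plus dx Mbar i)) ->
     cfl (geqmom a) dx dt cells Mbar ->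
     forall i : int, cells i ->
       strictly_realizable (update (geqmom a) dx dt Mbar i)) /\
  (cfl (hyqmom R) dx dt cells Mbar ->
     forall i : int, cells i ->
       realizable (update (hyqmom R) dx dt Mbar i)).
Proof.
move=> dx_gt0 dt_gt0 _ recon_strict.
have la_gt0 : 0 < dt / dx by rewrite divr_gt0.
have right_of i : cells i -> interfaces cells i by left.
have left_of i : cells i -> interfaces cells (i - 1) by right; rewrite subrK.
split=> [a a_gt adm cflP i cell_i|cflP i cell_i]; rewrite update_half_steps.
- have [admR admR'] := adm _ (right_of _ cell_i).
  have [admL admL'] := adm _ (left_of _ cell_i).
  apply/hankel_minors_pos_strictly_realizable/hankel_pos_minors => b c d bcd.
  rewrite hankel_formD ltr_pwDl//.
    apply: geqmom_half_step_hankel_pos bcd => //.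
    exact: cfl_interface cflP (right_of _ cell_i).
  apply/hankel_form_ge0/hll_half_step_p_realizable => //.
  + exact: cfl_interface cflP (left_of _ cell_i).
  + exact: geqmom_resolves.
  + exact: geqmom_resolves.
- have [/hyqmom_resolves[sR RR] /hyqmom_resolves[sR' RR']] :=
    recon_strict _ (right_of _ cell_i).
  have [/hyqmom_resolves[sL RL] /hyqmom_resolves[sL' RL']] :=
    recon_strict _ (left_of _ cell_i).
  apply: realizableD.
  + apply: hll_half_step_m_realizable RR RR' => //.
    exact: cfl_interface cflP (right_of _ cell_i).
  + apply: hll_half_step_p_realizable RL RL' => //.
    exact: cfl_interface cflP (left_of _ cell_i).
Qed.
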